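(* Let $A\subset\mathbb{R}^d$ be a finite set. The multicover bifiltration $\mathrm{Cov}=(\mathrm{Cov}_{r,k})_{(r,k)\in[0,\infty)\times\mathbb{N}}$ of $A$ is weakly equivalent to the bifiltration $\textnormal{S-Del}=(\textnormal{S-Del}_{r,k})_{(r,k)\in[0,\infty)\times\mathbb{N}}$ (of geometric realizations of the simplicial complexes defined below).
   Context: $\mathbb{N}=\{1,2,3,\dots\}$. Bifiltrations here are indexed by $[0,\infty)\times\mathbb{N}$ with the order $(r,k)\le(r',k')$ iff $r\le r'$ and $k\ge k'$; a bifiltration is a family of topological spaces $X_{r,k}$ with $X_{r,k}\subseteq X_{r',k'}$ whenever $(r,k)\le(r',k')$. A morphism $\varphi:X\to Y$ of bifiltrations is a family of continuous maps $\varphi_{r,k}:X_{r,k}\to Y_{r,k}$ commuting with the inclusions; it is an objectwise homotopy equivalence if every $\varphi_{r,k}$ is a homotopy equivalence. $X$ and $Y$ are weakly equivalent if there is a finite zigzag $X\to Z_1\leftarrow Z_2\to\cdots\leftarrow Z_{m}\to\cdots\leftarrow Y$ of objectwise homotopy equivalences of bifiltrations connecting them. Multicover: $\mathrm{Cov}_{r,k}=\{b\in\mathbb{R}^d : \|b-a\|\le r \text{ for at least } k \text{ points } a\in A\}$. For $\tilde A\subseteq A$ let $\mathrm{Ball}_r(\tilde A)=\{b\in\mathbb{R}^d: \|b-\tilde a\|\le r \ \forall \tilde a\in\tilde A\}$ and, for $|\tilde A|=k$, the order-$k$ Voronoi region $\mathrm{Vor}(\tilde A)=\{b\in\mathbb{R}^d: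 \|b-\tilde a\|\le\|b-a\|\ \forall\tilde a\in\tilde A, a\in A\setminus\tilde A\}$. Let $\mathfrak{V}_{r,k}=\{\mathrm{Ball}_r(\tilde A)\cap\mathrm{Vor}(\tilde A): \tilde A\subseteq A, |\tilde A|=k\}$ (empty if $k>|A|$). Let $\mathrm{Del}^{+}_{r,k}$ be the nerve of $\mathfrak{V}_{r,k}\cup\mathfrak{V}_{r,k+1}$: the abstract simplicial complex whose vertices are subsets $\tilde A\subseteq A$ with $|\tilde A|\in\{k,k+1\}$ and whose simplices are the finite sets $\sigma$ of such subsets with $\bigcap_{\tilde A\in\sigma}\big(\mathrm{Ball}_r(\tilde A)\cap\mathrm{Vor}(\tilde A)\big)\neq\emptyset$. Define $\textnormal{S-Del}_{r,k}=\bigcup_{i\ge k}\mathrm{Del}^{+}_{r,i}$ (union of simplicial complexes on the common vertex set of subsets of $A$). *)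

(* Defs.v *)
From HB Require Import structures.
From mathcomp Require Import all_boot all_order all_algebra finmap.
From mathcomp Require Import all_classical all_reals all_analysis.

Set Implicit Arguments.
Unset Strict Implicit.
Unset Printing Implicit Defensive.

Import Order.TTheory GRing.Theory Num.Theory.
Import numFieldNormedType.Exports.
Local Open Scope classical_set_scope.
Local Open Scope ring_scope.

Section Homotopy.
Variable R : realType.

(** [f] and [g] are homotopic: there is a continuous H : [0,1] x X -> Y
    with H(0,-) = f and H(1,-) = g.  H is given as a total function on
    R * X, only its restriction to [0,1] x X matters. *)
Definition homotopic {X Y : topologicalType} (f g : X -> Y) : Prop :=
  exists H : (R * X)%type -> Y,
    {within `[0, 1]%classic `*` [set: X], continuous H} /\
    (forall x, H (0, x) = f x) /\ (forall x, H (1, x) = g x).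

Definition homotopy_equivalence {X Y : topologicalType} (f : X -> Y) : Prop :=
  continuous f /\
  exists g : Y -> X, continuous g /\
    homotopic (g \o f) idfun /\ homotopic (f \o g) idfun.

End Homotopy.

Section Bifiltration.
Variable R : realType.

Definition idx_le (r : R) (k : nat) (r' : R) (k' : nat) : bool :=
  [&& 0 <= r, r <= r', (0 < k')%N & (k' <= k)%N].

Definition idx_ok (r : R) (k : nat) : bool := (0 <= r) && (0 < k)%N.

(** A bifiltration: a space for every index, together with the inclusion
    maps X_{r,k} -> X_{r',k'} for (r,k) <= (r',k'): continuous, injective,
    and compatible (identity on X_{r,k}, closed under composition).
    Only the valid indices (r >= 0, k >= 1) are constrained. *)
Record bifiltration := Bifiltration {
  bf_space : R -> nat -> topologicalType;
  bf_incl : forall r k r' k', idx_le r k r' k' ->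
     bf_space r k -> bf_space r' k';
  bf_incl_cont : forall r k r' k' (h : idx_le r k r' k'),
     continuous (bf_incl h);
  bf_incl_inj : forall r k r' k' (h : idx_le r k r' k'),
     injective (bf_incl h);
  bf_incl_id : forall r k (h : idx_le r k r k) x, bf_incl h x = x;
  bf_incl_comp : forall r k r' k' r'' k'' (h1 : idx_le r k r' k')
     (h2 : idx_le r' k' r'' k'') (h3 : idx_le r k r'' k'') x,
     bf_incl h2 (bf_incl h1 x) = bf_incl h3 x
}.

Unset Implicit Arguments.
Record bf_morphism (X Y : bifiltration) := BfMorphism {
  bfm_fun : forall r k, bf_space X r k -> bf_space Y r k;
  bfm_cont : forall r k, idx_ok r k -> continuous (bfm_fun r k);
  bfm_comm : forall r k r' k' (h : idx_le r k r' k') x,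
     bfm_fun r' k' (@bf_incl X r k r' k' h x) =
       @bf_incl Y r k r' k' h (bfm_fun r k x)
}.

Set Implicit Arguments.

Definition objectwise_he (X Y : bifiltration) (phi : bf_morphism X Y) : Prop :=
  forall r k, idx_ok r k -> homotopy_equivalence R (@bfm_fun X Y phi r k).

Inductive zigzag : bifiltration -> bifiltration -> Prop :=
| zigzag_refl X : zigzag X X
| zigzag_fwd X Y Z (phi : bf_morphism X Y) :
    objectwise_he phi -> zigzag Y Z -> zigzag X Z
| zigzag_bwd X Y Z (phi : bf_morphism Y X) :
    objectwise_he phi -> zigzag Y Z -> zigzag X Z.

Definition weakly_equivalent (X Y : bifiltration) : Prop := zigzag X Y.

(** Bifiltration given by a monotone family of subsets of a fixed space,
    each carrying the subspace topology. *)
Section OfSets.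
Variables (T : topologicalType) (X : R -> nat -> set T).
Hypothesis hX : forall r k r' k', idx_le r k r' k' -> X r k `<=` X r' k'.

Definition sets_incl r k r' k' (h : idx_le r k r' k') (x : X r k) : X r' k' :=
  exist _ (val x) (mem_set (hX h (set_valP x))).

Lemma sets_incl_cont r k r' k' (h : idx_le r k r' k') :
  continuous (sets_incl h).
Proof.
apply: continuous_comp_initial.
exact: (@initial_continuous (X r k) T set_val).
Qed.

Lemma sets_incl_inj r k r' k' (h : idx_le r k r' k') :
  injective (sets_incl h).
Proof. by move=> x y /(congr1 val) /= /val_inj. Qed.

Lemma sets_incl_id r k (h : idx_le r k r k) x : sets_incl h x = x.
Proof. exact: val_inj. Qed.

Lemma sets_incl_comp r k r' k' r'' k'' (h1 : idx_le r k r' k')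
     (h2 : idx_le r' k' r'' k'') (h3 : idx_le r k r'' k'') x :
     sets_incl h2 (sets_incl h1 x) = sets_incl h3 x.
Proof. exact: val_inj. Qed.

Definition bifiltration_of_sets : bifiltration :=
  @Bifiltration (fun r k => X r k) sets_incl sets_incl_cont sets_incl_inj
    sets_incl_id sets_incl_comp.
End OfSets.

End Bifiltration.

Section Multicover.
Variables (R : realType) (d : nat) (A : {fset 'rV[R]_d}).

Definition enorm (v : 'rV[R]_d) : R := Num.sqrt (\sum_(i < d) v 0 i ^+ 2).

Definition Cov (r : R) (k : nat) : set 'rV[R]_d :=
  [set b | (k <= #|[set a : A | (enorm (b - val a) <= r)%R]%SET|)%N].

Definition Ball (r : R) (S : {set A}) : set 'rV[R]_d :=
  [set b | forall a : A, a \in S -> enorm (b - val a) <= r].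

Definition Vor (S : {set A}) : set 'rV[R]_d :=
  [set b | forall a a' : A, a \in S -> a' \notin S ->
           enorm (b - val a) <= enorm (b - val a')].

(** Simplices of Del^+_{r,k}: the nerve of V_{r,k} u V_{r,k+1}, whose
    vertices are subsets S of A with |S| in {k, k+1}. *)
Definition DelPlus_simplex (r : R) (k : nat) (sigma : {set {set A}}) : Prop :=
  (forall S, S \in sigma -> #|S| = k \/ #|S| = k.+1) /\
  exists b : 'rV[R]_d, forall S, S \in sigma -> (Ball r S `&` Vor S) b.

Definition SDel_simplex (r : R) (k : nat) (sigma : {set {set A}}) : Prop :=
  exists i : nat, (k <= i)%N /\ DelPlus_simplex r i sigma.

(** Geometric realization of a simplicial complex K on the finite vertex
    set {set A}: barycentric coordinate functions t with support a simplex
    of K, topologized as a subspace of the product R^{set A}. *)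
Definition realization (K : {set {set A}} -> Prop) : set {ptws {set A} -> R} :=
  [set t | (forall v, 0 <= t v) /\ (\sum_v t v = 1) /\
           K [set v : {set A} | t v != 0]%SET].

Definition SDel_space (r : R) (k : nat) : set {ptws {set A} -> R} :=
  realization (SDel_simplex r k).

Lemma Cov_mono r k r' k' : idx_le r k r' k' -> Cov r k `<=` Cov r' k'.
Proof.
case/and4P=> _ rr' _ kk' b; rewrite /Cov /= => h.
apply: (leq_trans kk'); apply: (leq_trans h); apply: subset_leq_card.
apply/fintype.subsetP=> a; rewrite !inE => /le_trans; apply; exact: rr'.
Qed.

Lemma SDel_mono r k r' k' : idx_le r k r' k' -> SDel_space r k `<=` SDel_space r' k'.
Proof.
case/and4P=> _ rr' _ kk' t [t0 [t1 [i [ki [hS [b hb]]]]]].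
split=> //; split=> //; exists i; split; first exact: leq_trans ki.
split=> // ; exists b => S /hb [hB hV]; split=> // a aS.
exact: le_trans (hB a aS) rr'.
Qed.

Definition Cov_bifiltration : bifiltration R := @bifiltration_of_sets R 'rV[R]_d Cov Cov_mono.
Definition SDel_bifiltration : bifiltration R :=
  @bifiltration_of_sets R {ptws {set A} -> R} SDel_space SDel_mono.

End Multicover.

(* Main.v *)
Require Import Defs.
From HB Require Import structures.
From mathcomp Require Import all_boot all_order all_algebra finmap.
From mathcomp Require Import all_classical all_reals all_analysis.
From mathcomp Require Import ring lra.

(* Write D_S for the closed convex set Ball_r(S) `&` Vor(S).  The zigzag is
   Cov <- Z -> S-Del, where Z_{r,k} consists of the pairs (b, t) such that t is
   supported on sets S of two consecutive sizes i, i+1 with i >= k and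
   b \in D_S; the arrows are the projections.

   For finitely many convex sets C_v, nerve_map sends nonnegative weights l
   supported on a simplex of the nerve to a point lying in C_v whenever
   l_v >= 1/2.  It is a weighted average of points p_J chosen in the
   intersections of the C_v (v \in J), where p_J gets positive weight only if
   {l >= 1/2} <= J <= supp l.

   Z -> S-Del: rescale t so that some weight is at least 1.  The homotopy
   inverse is t |-> (nerve_map t, t truncated at 1/2), and both homotopies are
   straight lines, first in t and then in b.

   Z -> Cov: weight S by 1 if b \in D_S, decreasing to 0 near D_S so fast that
   the support is always a simplex.  The resulting centre m b lies in every D_S
   that contains b, hence so does the segment from b to m b.  The fibre of Z
   over a point is a chain of simplices glued along consecutive sizes; it is
   contracted by moving the mean size of t linearly down to k. *)

Set Implicit Arguments.
Unset Strict Implicit.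
Unset Printing Implicit Defensive.

Import Order.TTheory GRing.Theory Num.Theory.
Import numFieldNormedType.Exports.
Local Open Scope classical_set_scope.
Local Open Scope ring_scope.

(** * Continuous maps and homotopies between subsets *)

Section Continuity.
Context {R : realType} {T : topologicalType}.
Implicit Types f g : T -> R.

Lemma continuous_maxr f g : continuous f -> continuous g ->
  continuous (fun x => Num.max (f x) (g x)).
Proof. by move=> cf cg x; apply: continuous_max; [exact: cf|exact: cg]. Qed.

Lemma continuous_minr f g : continuous f -> continuous g ->
  continuous (fun x => Num.min (f x) (g x)).
Proof. by move=> cf cg x; apply: continuous_min; [exact: cf|exact: cg]. Qed.

Lemma continuous_mulr f g : continuous f -> continuous g ->
  continuous (fun x => f x * g x).
Proof. by move=> cf cg x; apply: cvgM; [exact: cf|exact: cg]. Qed.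

Lemma continuous_addv (V : normedModType R) (f g : T -> V) :
  continuous f -> continuous g -> continuous (fun x => f x + g x).
Proof. by move=> cf cg x; apply: cvgD; [exact: cf|exact: cg]. Qed.

Lemma continuous_subv (V : normedModType R) (f g : T -> V) :
  continuous f -> continuous g -> continuous (fun x => f x - g x).
Proof. by move=> cf cg x; apply: cvgB; [exact: cf|exact: cg]. Qed.

Lemma continuous_scalev (V : normedModType R) f (g : T -> V) :
  continuous f -> continuous g -> continuous (fun x => f x *: g x).
Proof. by move=> cf cg x; apply: cvgZ; [exact: cf|exact: cg]. Qed.

Lemma continuous_invr f : (forall x, f x != 0) -> continuous f ->
  continuous (fun x => (f x)^-1).
Proof. by move=> f0 cf x; apply: cvgV => //; exact: cf. Qed.

Lemma continuous_sumv (V : normedModType R) (I : Type) (s : seq I) (P : pred I)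
    (F : I -> T -> V) : (forall i, P i -> continuous (F i)) ->
  continuous (fun x => \sum_(i <- s | P i) F i x).
Proof.
move=> cF x; apply: cvg_big => [[a b]|i Pi]; last exact: cF.
exact: add_continuous.
Qed.

Lemma continuous_prodr (I : Type) (s : seq I) (P : pred I) (F : I -> T -> R) :
  (forall i, P i -> continuous (F i)) ->
  continuous (fun x => \prod_(i <- s | P i) F i x).
Proof.
move=> cF x; apply: cvg_big => [[a b]|i Pi]; last exact: cF.
exact: mul_continuous.
Qed.

Lemma continuous_bigmin (I : Type) (s : seq I) (P : pred I) (F : I -> T -> R)
    (z : R) : (forall i, P i -> continuous (F i)) ->
  continuous (fun x => \big[Num.min/z]_(i <- s | P i) F i x).
Proof.
move=> cF x; apply: (@cvg_big R) => [|i Pi]; last exact: cF.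
move=> [a b]; apply: continuous_min; last exact: cvg_snd.
exact: cvg_fst.
Qed.

Lemma continuous_ptws (I : choiceType) (F : T -> {ptws I -> R}) :
  (forall i, continuous (fun x => F x i)) -> continuous F.
Proof.
move=> cF x; apply/cvg_sup => i.
by apply: (@continuous_comp_initial _ _ _ (fun f : I -> R => f i) F); exact: cF.
Qed.

Lemma continuous_pairv (U V : topologicalType) (f : T -> U) (g : T -> V) :
  continuous f -> continuous g -> continuous (fun x => (f x, g x)).
Proof. by move=> cf cg x; apply: cvg_pair; [exact: cf|exact: cg]. Qed.

Lemma continuous_compose (U V : topologicalType) (f : T -> U) (g : U -> V) :
  continuous f -> continuous g -> continuous (fun x => g (f x)).
Proof. by move=> cf cg x; apply: continuous_comp; [exact: cf|exact: cg]. Qed.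

End Continuity.

Lemma ptws_eval_continuous (R : realType) (I : choiceType) (i : I) :
  continuous (fun t : {ptws I -> R} => t i).
Proof. exact: (@proj_continuous I (fun=> R) i). Qed.

(** * Homotopy equivalences between subsets of ambient spaces *)

Section SubsetMaps.
Context {R : realType}.

(** Extends homotopies to all real times, as [homotopic] asks for a total function; composed with
    affine maps it also concatenates homotopies. *)
Definition clamp01 (s : R) : R := Num.max 0 (Num.min s 1).

Lemma clamp01_itv s : 0 <= clamp01 s <= 1.
Proof. by rewrite /clamp01 le_max lexx /= ge_max ler01 ge_min lexx orbT. Qed.

Lemma clamp01_le0 s : s <= 0 -> clamp01 s = 0.
Proof.
by move=> s0; apply/max_idPl; rewrite ge_min s0.
Qed.

Lemma clamp01_ge1 s : 1 <= s -> clamp01 s = 1.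
Proof.
by move=> s1; rewrite /clamp01 min_r// max_r.
Qed.

Lemma continuous_clamp01 (T : topologicalType) (f : T -> R) :
  continuous f -> continuous (fun x => clamp01 (f x)).
Proof.
move=> cf; apply: continuous_maxr; first exact: cst_continuous.
by apply: continuous_minr => //; exact: cst_continuous.
Qed.

Definition restr_map (T U : Type) (X : set T) (Y : set U) (f : T -> U)
  (fXY : forall x, X x -> Y (f x)) (x : X) : Y :=
  exist _ (f (val x)) (mem_set (fXY _ (set_valP x))).

Lemma restr_map_continuous (T U : topologicalType) (X : set T) (Y : set U)
    (f : T -> U) (fXY : forall x, X x -> Y (f x)) :
  continuous f -> continuous (restr_map fXY).
Proof.
move=> cf; apply: continuous_comp_initial => x.
apply: (@continuous_comp _ _ _ set_val f); last exact: cf.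
exact: (@initial_continuous X T set_val).
Qed.

Lemma homotopic_restr (T : topologicalType) (X : set T) (g : X -> X)
    (H : R -> T -> T) :
  continuous (fun z : R * T => H z.1 z.2) ->
  (forall s x, 0 <= s <= 1 -> X x -> X (H s x)) ->
  (forall x, X x -> H 0 x = x) -> (forall x : X, H 1 (val x) = val (g x)) ->
  homotopic R g idfun.
Proof.
move=> cH HX H0 H1.
(* Time is reversed because [H] starts at the identity, where [homotopic] has to end. *)
have HX' (z : R * X) : X (H (clamp01 (1 - z.1)) (val z.2)).
  by apply: HX; [exact: clamp01_itv|exact: set_valP].
pose K (z : R * X) : X := exist _ (H (clamp01 (1 - z.1)) (val z.2)) (mem_set (HX' z)).
exists K; split; last first.
  split=> x; apply: val_inj => /=.
    by rewrite subr0 clamp01_ge1// H1.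
  by rewrite subrr clamp01_le0// H0//; exact: set_valP.
apply: continuous_subspaceT; apply: continuous_comp_initial.
have c1 : continuous (fun z : R * X => (clamp01 (1 - z.1), val z.2)).
  apply: continuous_pairv.
    apply: continuous_clamp01; apply: continuous_subv.
      exact: cst_continuous.
    by move=> z; exact: cvg_fst.
  move=> z; apply: (@continuous_comp _ _ _ snd (set_val : X -> T)).
    exact: cvg_snd.
  exact: (@initial_continuous X T set_val).
exact: (continuous_compose c1 cH).
Qed.

(** All data are continuous on the ambient spaces and merely restrict to [X] and [Y]; for this the
    later formulas are total, with denominators that never vanish. *)
Lemma homotopy_equivalence_restr (T U : topologicalType) (X : set T) (Y : set U)
    (f : T -> U) (g : U -> T) (fXY : forall x, X x -> Y (f x))
    (HX : R -> T -> T) (HY : R -> U -> U) :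
  continuous f -> continuous g -> (forall y, Y y -> X (g y)) ->
  continuous (fun z : R * T => HX z.1 z.2) ->
  (forall s x, 0 <= s <= 1 -> X x -> X (HX s x)) ->
  (forall x, X x -> HX 0 x = x) -> (forall x, X x -> HX 1 x = g (f x)) ->
  continuous (fun z : R * U => HY z.1 z.2) ->
  (forall s y, 0 <= s <= 1 -> Y y -> Y (HY s y)) ->
  (forall y, Y y -> HY 0 y = y) -> (forall y, Y y -> HY 1 y = f (g y)) ->
  homotopy_equivalence R (restr_map fXY).
Proof.
move=> cf cg gYX cHX HXX HX0 HX1 cHY HYY HY0 HY1.
split; first exact: restr_map_continuous.
exists (restr_map gYX); split; first exact: restr_map_continuous.
split.
  by apply: (homotopic_restr cHX) => // x; rewrite HX1//; exact: set_valP.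
by apply: (homotopic_restr cHY) => // x; rewrite HY1//; exact: set_valP.
Qed.

End SubsetMaps.

(** * Maps from and to the nerve of a finite family of convex sets *)

Definition is_convex (R : realType) (E : lmodType R) (C : set E) :=
  forall s x y, 0 <= s <= 1 -> C x -> C y -> C ((1 - s) *: x + s *: y).

Lemma is_convex_barycenter (R : realType) (E : lmodType R) (C : set E)
    (I : finType) (w : I -> R) (x : I -> E) : is_convex C ->
  (forall i, 0 <= w i) -> (forall i, w i != 0 -> C (x i)) ->
  0 < \sum_i w i -> C ((\sum_i w i)^-1 *: \sum_i w i *: x i).
Proof.
move=> Cc w0 wC.
suff: (\sum_i w i = 0) \/
    0 < \sum_i w i /\ C ((\sum_i w i)^-1 *: \sum_i w i *: x i).
  by case=> [->|[]//]; rewrite ltxx.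
(* Induction on the list of indices. As long as all weights are zero there is no barycentre; the
   weighted sum of points is then zero too, so the first positive weight yields its own point. *)
suff: (\sum_i w i = 0 /\ \sum_i w i *: x i = 0) \/
    0 < \sum_i w i /\ C ((\sum_i w i)^-1 *: \sum_i w i *: x i).
  by case=> [[]|]; [left|right].
elim: (index_enum I) => [|i r IH]; first by left; rewrite !big_nil.
rewrite !big_cons; have [wi0|wi0] := eqVneq (w i) 0.
  by rewrite wi0 scale0r !add0r.
right; have wi : 0 < w i by rewrite lt_def wi0 w0.
case: IH => [[-> ->]|[W CW]].
  by rewrite !addr0 scalerA mulVf// scale1r; split=> //; exact: wC.
split; first exact: addr_gt0.
set W' := \sum_(j <- r) w j in W CW *; set v := \sum_(j <- r) _ in CW *.
have WW : w i + W' != 0 by rewrite gt_eqF// addr_gt0.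
have -> : (w i + W')^-1 *: (w i *: x i + v) =
    (1 - W' / (w i + W')) *: x i + (W' / (w i + W')) *: (W'^-1 *: v).
  have -> : 1 - W' / (w i + W') = (w i + W')^-1 * w i by field.
  rewrite scalerDr !scalerA; congr (_ + _ *: _).
  by field; rewrite WW gt_eqF.
apply: Cc => //; last exact: wC.
rewrite divr_ge0 ?addr_ge0 ?(ltW W)//= ler_pdivrMr ?addr_gt0// mul1r.
by rewrite lerDr.
Qed.

Section Nerve.
Context {R : realType} {E : normedModType R} {I : finType}.
Context (C : I -> set E).
Implicit Types (l : {ptws I -> R}) (J : {set I}) (P : pred I).

(** A default point if the intersection is empty; such [J] have weight zero whenever the support of
    [l] is a simplex. *)
Definition nerve_pt J : E := get [set b | forall v, v \in J -> C v b].

Definition flag_weight J l : R :=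
  \prod_v (if v \in J then l v else Num.max 0 (2^-1 - l v)).

Definition nerve_map l : E :=
  (\sum_J flag_weight J l)^-1 *: \sum_J flag_weight J l *: nerve_pt J.

(** The sum over [J] expands the product of the factors max(l v, 1/2). Positivity for every [l]
    makes [nerve_map] continuous everywhere. *)
Lemma sum_flag_weight_gt0 l : 0 < \sum_J flag_weight J l.
Proof.
have -> : \sum_J flag_weight J l = \prod_v (l v + Num.max 0 (2^-1 - l v)).
  by rewrite bigA_distr; apply: eq_bigl => J; rewrite inE.
apply: prodr_gt0 => v _; rewrite addr_maxr addr0 addrC subrK.
by rewrite lt_max invr_gt0 ltr0n orbT.
Qed.

Lemma flag_weight_ge0 J l : (forall v, 0 <= l v) -> 0 <= flag_weight J l.
Proof.
by move=> l0; apply: prodr_ge0 => v _; case: ifP => // _; rewrite le_max lexx.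
Qed.

(** A [J] of nonzero weight contains [v], else its factor at [v] would be 0. It also lies in the
    support of [l], so its chosen point lies in [C v], and convexity handles the average. *)
Lemma nerve_map_in l v : is_convex (C v) -> (forall u, 0 <= l u) ->
  (exists b, forall u, l u != 0 -> C u b) -> 2^-1 <= l v ->
  C v (nerve_map l).
Proof.
move=> Cc l0 [b lb] lv; apply: is_convex_barycenter => //.
- by move=> J; exact: flag_weight_ge0.
- move=> J /prodf_neq0 wJ.
  have vJ : v \in J.
    apply: contraT => vJ; have := wJ v isT.
    by rewrite (negbTE vJ) max_l ?eqxx// subr_le0.
  suff : (forall u, u \in J -> C u (nerve_pt J)) by apply.
  apply: (@getPex _ [set b | forall v, v \in J -> C v b]); exists b => u uJ.
  by apply: lb; have := wJ u isT; rewrite uJ.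
- exact: sum_flag_weight_gt0.
Qed.

Lemma flag_weight_continuous J : continuous (flag_weight J).
Proof.
apply: continuous_prodr => v _; case: (v \in J); first exact: ptws_eval_continuous.
apply: continuous_maxr; first exact: cst_continuous.
by apply: continuous_subv; [exact: cst_continuous|exact: ptws_eval_continuous].
Qed.

Lemma nerve_map_continuous : continuous nerve_map.
Proof.
apply: continuous_scalev; last first.
  apply: continuous_sumv => J _; apply: continuous_scalev.
    exact: flag_weight_continuous.
  exact: cst_continuous.
apply: continuous_invr => [l|]; first by rewrite gt_eqF ?sum_flag_weight_gt0.
by apply: continuous_sumv => J _; exact: flag_weight_continuous.
Qed.

(* The denominator is bounded below by 1/2 only to make [soften] continuous
   everywhere: it is the plain sum as soon as some l v with P v is >= 1. *)
Definition soften P l : {ptws I -> R} := fun v =>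
  if P v then Num.max 0 (l v - 2^-1) /
    Num.max 2^-1 (\sum_(u | P u) Num.max 0 (l u - 2^-1)) else 0.

Lemma soften_ge0 P l v : 0 <= soften P l v.
Proof.
rewrite /soften; case: ifP => // _.
by rewrite divr_ge0// le_max ?lexx// invr_ge0 ler0n.
Qed.

(** Ensures that [nerve_map_in] applies at every vertex of the softened support. *)
Lemma soften_neq0 P l v : soften P l v != 0 -> P v /\ 2^-1 < l v.
Proof.
rewrite /soften; case: ifP => [_|]; last by rewrite eqxx.
have [|lv] := leP (l v) 2^-1; last by [].
by move=> lv; rewrite max_l ?subr_le0// mul0r eqxx.
Qed.

Lemma sum_soften P l : (exists2 v, P v & 1 <= l v) ->
  \sum_(v | P v) soften P l v = 1.
Proof.
case=> v Pv lv; rewrite /soften.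
rewrite (eq_bigr (fun u => Num.max 0 (l u - 2^-1) /
  Num.max 2^-1 (\sum_(u | P u) Num.max 0 (l u - 2^-1)))); last by move=> u ->.
have S : 2^-1 <= \sum_(u | P u) Num.max 0 (l u - 2^-1).
  rewrite (bigD1 v)//= -[leLHS]addr0 lerD//; last first.
    by apply: sumr_ge0 => u _; rewrite le_max lexx.
  by rewrite le_max; apply/orP; right; lra.
rewrite -mulr_suml max_r// mulfV// gt_eqF//.
by rewrite (lt_le_trans _ S)// invr_gt0 ltr0n.
Qed.

Lemma soften_continuous P : continuous (soften P).
Proof.
have cm u : continuous (fun l => Num.max 0 (l u - 2^-1)).
  apply: continuous_maxr; first exact: cst_continuous.
  by apply: continuous_subv; [exact: ptws_eval_continuous|exact: cst_continuous].
apply: continuous_ptws => v; rewrite /soften; case: (P v); last exact: cst_continuous.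
apply: continuous_mulr; first exact: cm.
apply: continuous_invr => [l|].
  by rewrite gt_eqF// lt_max invr_gt0 ltr0n.
apply: continuous_maxr; first exact: cst_continuous.
by apply: continuous_sumv => u _; exact: cm.
Qed.

(** * Weights on the nerve from functions vanishing exactly on the sets *)

Context (e : I -> E -> R).
Context (e_ge0 : forall v b, 0 <= e v b).
Context (eE : forall v b, e v b = 0 <-> C v b).
Context (e_continuous : forall v, continuous (e v)).

(* A positive number, continuous in b, such that the v with e v b below it
   always span a simplex of the nerve. *)
Definition nerve_gap (b : E) : R :=
  \big[Num.min/1]_(J : {set I} | ~~ `[< exists x, forall v, v \in J -> C v x >])
    ((\sum_(v in J) e v b) / #|I|.+1%:R).

Definition near_weight (b : E) : {ptws I -> R} :=
  fun v => Num.max 0 (1 - e v b / nerve_gap b).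

(** A non-simplex [J] has no common point, so some [e v b] with [v] in [J] is positive. *)
Lemma nerve_gap_gt0 b : 0 < nerve_gap b.
Proof.
rewrite /nerve_gap; apply: (big_ind (fun x : R => 0 < x)) => //.
  by move=> x y; rewrite lt_min => -> ->.
move=> J /asboolPn nJ; rewrite divr_gt0 ?ltr0n//.
rewrite lt_def sumr_ge0 ?andbT//; apply/negP => /eqP e0.
apply: nJ; exists b => v vJ; apply/eE/eqP; move: e0 => /eqP.
by rewrite psumr_eq0// => /allP/(_ v (mem_index_enum v)); rewrite vJ.
Qed.

Lemma near_weight_ge0 b v : 0 <= near_weight b v.
Proof. by rewrite /near_weight le_max lexx. Qed.

Lemma near_weight1 b v : C v b -> near_weight b v = 1.
Proof. by move=> /eE evb; rewrite /near_weight evb mul0r subr0 max_r. Qed.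

(** Were the support [J] no simplex, each [e v b] on it being below the gap, their sum would be at
    most |J| times the gap, hence less than |I|+1 times it, against the definition of the gap. *)
Lemma near_weight_nerve b :
  exists x, forall v, near_weight b v != 0 -> C v x.
Proof.
pose J := [set v | near_weight b v != 0]%SET.
suff: exists x, forall v, v \in J -> C v x.
  by case=> x Jx; exists x => v vJ; apply: Jx; rewrite inE.
apply/asboolP; apply: contraT => nJ.
have : nerve_gap b <= (\sum_(v in J) e v b) / #|I|.+1%:R.
  by rewrite /nerve_gap (bigD1 J)//= ge_min lexx.
rewrite ler_pdivlMr ?ltr0n// leNgt; case/negP.
apply: (@le_lt_trans _ _ (\sum_(v in J) nerve_gap b)).
  apply: ler_sum => v; rewrite inE => vJ; rewrite leNgt; apply: contra vJ.
  move=> gv; rewrite /near_weight max_l// subr_le0.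
  by rewrite ler_pdivlMr ?nerve_gap_gt0// mul1r ltW.
rewrite sumr_const -[_ *+ #|_|]mulr_natr ltr_pM2l ?nerve_gap_gt0// ltr_nat ltnS.
exact: max_card.
Qed.

Lemma near_weight_continuous : continuous near_weight.
Proof.
apply: continuous_ptws => v; apply: continuous_maxr; first exact: cst_continuous.
apply: continuous_subv; first exact: cst_continuous.
apply: continuous_mulr => //; apply: continuous_invr => [b|].
  by rewrite gt_eqF ?nerve_gap_gt0.
apply: continuous_bigmin => J _; apply: continuous_mulr.
  by apply: continuous_sumv => u _.
exact: cst_continuous.
Qed.

End Nerve.

(** * The blowup of the multicover *)

Section EuclideanConvexity.
Context {R : realType} {d : nat}.
Implicit Types (x y c : 'rV[R]_d) (A : {fset 'rV[R]_d}).

Lemma enorm_ge0 x : 0 <= enorm x.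
Proof. exact: sqrtr_ge0. Qed.

Lemma sqr_enorm x : enorm x ^+ 2 = \sum_(i < d) x 0 i ^+ 2.
Proof. by rewrite sqr_sqrtr// sumr_ge0// => i _; exact: sqr_ge0. Qed.

Lemma enorm_continuous c : continuous (fun x => enorm (x - c)).
Proof.
apply: (@continuous_compose _ R _ (fun x => \sum_(i < d) (x - c) 0 i ^+ 2));
  last exact: sqrt_continuous.
apply: continuous_sumv => i _.
have ci : continuous (fun x => (x - c) 0 i).
  have -> : (fun x => (x - c) 0 i) = (fun x => x 0 i - c 0 i).
    by apply/funext => x; rewrite !mxE.
  by apply: continuous_subv; [exact: coord_continuous|exact: cst_continuous].
exact: continuous_mulr.
Qed.

(* Stewart's identity: the last term does not depend on c, so it cancels
   from comparisons of distances to two sites. *)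
Lemma sqr_enorm_comb s x y c : enorm ((1 - s) *: x + s *: y - c) ^+ 2 =
  (1 - s) * enorm (x - c) ^+ 2 + s * enorm (y - c) ^+ 2
  - s * (1 - s) * enorm (x - y) ^+ 2.
Proof.
rewrite !sqr_enorm !mulr_sumr -big_split -sumrB; apply: eq_bigr => i _ /=.
by rewrite !mxE; ring.
Qed.

Lemma Ball_convex A r (S : {set A}) : is_convex (Ball r S).
Proof.
move=> s x y /andP[s0 s1] Bx By a aS.
have xr := Bx a aS; have yr := By a aS.
have r0 : 0 <= r by exact: le_trans (enorm_ge0 _) xr.
rewrite -ler_sqr ?nnegrE ?enorm_ge0// sqr_enorm_comb.
have x2 : enorm (x - val a) ^+ 2 <= r ^+ 2.
  by rewrite ler_sqr ?nnegrE ?enorm_ge0.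
have y2 : enorm (y - val a) ^+ 2 <= r ^+ 2.
  by rewrite ler_sqr ?nnegrE ?enorm_ge0.
have xy : 0 <= s * (1 - s) * enorm (x - y) ^+ 2.
  by rewrite mulr_ge0 ?sqr_ge0// mulr_ge0// subr_ge0.
nra.
Qed.

Lemma Vor_convex A (S : {set A}) : is_convex (Vor S).
Proof.
move=> s x y /andP[s0 s1] Vx Vy a a' aS a'S.
rewrite -ler_sqr ?nnegrE ?enorm_ge0// !sqr_enorm_comb lerD2r.
by apply: lerD; apply: ler_wpM2l; rewrite ?subr_ge0// ler_sqr ?nnegrE ?enorm_ge0//;
  [exact: Vx|exact: Vy].
Qed.

(** Greedy choice: adjoin to [S] a site nearest to [b] among those outside [S]. *)
Lemma exists_Vor A b j : (j <= #|{: A}|)%N ->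
  exists S : {set A}, #|S| = j /\ Vor S b.
Proof.
elim: j => [|j IH] jA.
  by exists finset.set0; split; [rewrite cards0|move=> a a'; rewrite inE].
have [S [Sj VS]] := IH (ltnW jA).
have /existsP[a0 a0S] : [exists a, a \notin S].
  apply: contraTT jA; rewrite negb_exists => /forallP SA.
  rewrite -leqNgt -Sj; apply/subset_leq_card/fintype.subsetP => a _.
  by have := SA a; rewrite negbK.
have [a aS amin] := @arg_minP _ _ _ a0 (fun a => a \notin S)
  (fun a : A => enorm (b - val a)) a0S.
exists (a |: S)%SET; split; first by rewrite cardsU1 aS Sj.
move=> u u'; rewrite !inE negb_or => /orP[/eqP->|uS] /andP[_ u'S].
  exact: amin.
exact: VS.
Qed.

(** A [Vor] set of size j at [b] consists of j nearest sites. Were one of them farther than [r], all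
    sites within [r] would lie in the rest of the set, and there would be fewer than j. *)
Lemma CovP A r j b :
  Cov A r j b <-> exists S : {set A}, #|S| = j /\ (Ball r S `&` Vor S) b.
Proof.
split=> [bj|[S [<- [BS _]]]]; last first.
  by apply: subset_leq_card; apply/fintype.subsetP => a aS; rewrite inE; exact: BS.
have [S [Sj VS]] := @exists_Vor A b j (leq_trans bj (max_card _)).
exists S; split=> //; split=> // a aS; rewrite leNgt; apply/negP => ra.
suff : (#|[set a : A | (enorm (b - val a) <= r)%R]%SET| < j)%N by rewrite ltnNge bj.
rewrite -Sj; apply: proper_card; apply/properP; split; last first.
  by exists a => //; rewrite inE -ltNge.
apply/fintype.subsetP => u; rewrite inE => ur; apply: contraTT ra => uS.
by rewrite -leNgt (le_trans _ ur)//; exact: VS.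
Qed.

End EuclideanConvexity.

Section Mix.
Context {R : realType} {I : choiceType}.
Implicit Types (s : R) (t u : {ptws I -> R}).

Definition mix s t u : {ptws I -> R} := fun v => (1 - s) * t v + s * u v.

Lemma mix0 t u : mix 0 t u = t.
Proof. by apply/funext => v; rewrite /mix subr0 mul1r mul0r addr0. Qed.

Lemma mix1 t u : mix 1 t u = u.
Proof. by apply/funext => v; rewrite /mix subrr mul1r mul0r add0r. Qed.

Lemma continuous_mix (T : topologicalType) (f : T -> R)
    (g h : T -> {ptws I -> R}) :
  continuous f -> continuous g -> continuous h ->
  continuous (fun x => mix (f x) (g x) (h x)).
Proof.
move=> cf cg ch; apply: continuous_ptws => v; apply: continuous_addv.
  apply: continuous_mulr.
    by apply: continuous_subv => //; exact: cst_continuous.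
  exact: (continuous_compose cg (@ptws_eval_continuous R I v)).
apply: continuous_mulr => //.
exact: (continuous_compose ch (@ptws_eval_continuous R I v)).
Qed.

End Mix.

(** * The blowup and its cells *)

Section Blowup.
Context {R : realType} {d : nat}.
Context (A : {fset 'rV[R]_d}).
Local Notation E := 'rV[R]_d.
Local Notation V := {set A}.
Implicit Types (r : R) (k i : nat) (b : E) (t : {ptws V -> R}) (v : V).

(** For fixed [i] and [b] these [t] fill one simplex, possibly empty; the fibre of the blowup over
    [b] is the union over i >= k. *)
Definition in_cell r i b t := [/\ forall v, 0 <= t v, \sum_v t v = 1 &
  forall v, t v != 0 -> (#|v| = i \/ #|v| = i.+1) /\ (Ball r v `&` Vor v) b].

Definition blowup r k : set (E * {ptws V -> R}) :=
  [set z | exists2 i, (k <= i)%N & in_cell r i z.1 z.2].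

Lemma blowup_mono r k r' k' : idx_le r k r' k' -> blowup r k `<=` blowup r' k'.
Proof.
case/and4P=> _ rr' _ kk' [b t] [i ki [t0 t1 tD]].
exists i; first exact: leq_trans ki.
split=> // v /tD[vi [Bv Vv]]; split=> //; split=> // a /Bv ba.
exact: le_trans ba rr'.
Qed.

(** The point witnessing a simplex of the nerve becomes a coordinate. *)
Lemma SDelP r k t : SDel_space r k t <-> exists b, blowup r k (b, t).
Proof.
split=> [[t0 [t1 [i [ki [ti [b tb]]]]]]|[b [i ki [t0 t1 tD]]]].
  exists b; exists i => //; split=> // v tv.
  by split; [apply: ti|apply: tb]; rewrite inE.
split=> //; split=> //; exists i; split=> //; split=> [v|].
  by rewrite inE => /tD[].
by exists b => v; rewrite inE => /tD[].
Qed.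

Lemma blowup_SDel r k z : blowup r k z -> SDel_space r k z.2.
Proof. by move=> zB; apply/SDelP; exists z.1; case: z zB. Qed.

Lemma blowup_Cov r k z : blowup r k z -> Cov A r k z.1.
Proof.
move=> [i ki [t0 t1 tD]].
have [v tv] : exists v, z.2 v != 0.
  apply: contrapT => /forallNP tn; move: t1; rewrite big1 => [/esym/eqP|v _].
    by rewrite oner_eq0.
  by apply/eqP; have /negP := tn v; rewrite negbK.
have [vi [Bv _]] := tD v tv.
apply: (@leq_trans #|v|); first by case: vi => ->//; exact: leqW.
by apply: subset_leq_card; apply/fintype.subsetP => a av; rewrite inE; exact: Bv.
Qed.

Lemma in_cell_mix r i b t t' s : 0 <= s <= 1 ->
  in_cell r i b t -> in_cell r i b t' -> in_cell r i b (mix s t t').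
Proof.
move=> /andP[s0 s1] [t0 t1 tD] [t0' t1' tD']; split.
- by move=> v; rewrite addr_ge0 ?mulr_ge0 ?subr_ge0.
- by rewrite big_split/= -!mulr_sumr t1 t1'; ring.
- move=> v; have [tv|tv _] := eqVneq (t v) 0; last exact: tD.
  rewrite /mix tv mulr0 add0r => tv'; apply: tD'.
  by apply: contraNN tv' => /eqP->; rewrite mulr0.
Qed.

Lemma in_cell_move r i b b' t s : 0 <= s <= 1 ->
  in_cell r i b t -> in_cell r i b' t -> in_cell r i ((1 - s) *: b + s *: b') t.
Proof.
move=> s01 [t0 t1 tD] [_ _ tD']; split=> // v tv.
have [vi [Bb Vb]] := tD v tv; have [_ [Bb' Vb']] := tD' v tv.
by split=> //; split; [exact: Ball_convex|exact: Vor_convex].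
Qed.

Section FixedIndex.
Context (r : R) (k : nat).

(** Sets smaller than [k] get empty cells, while all sizes from [k] on enter the nerve together. *)
Definition cell v : set E := [set b | (k <= #|v|)%N /\ (Ball r v `&` Vor v) b].

(** Total violation of the conditions defining the cell. *)
Definition cell_excess v b : R := (#|v| < k)%:R
  + \sum_(a in v) Num.max 0 (enorm (b - val a) - r)
  + \sum_(a in v) \sum_(a' | a' \notin v)
      Num.max 0 (enorm (b - val a) - enorm (b - val a')).

Lemma cell_convex v : is_convex (cell v).
Proof.
move=> s x y s01 [kv [Bx Vx]] [_ [By Vy]]; split=> //.
by split; [exact: Ball_convex|exact: Vor_convex].
Qed.

Let max0_ge0 (x : R) : 0 <= Num.max 0 x. Proof. by rewrite le_max lexx. Qed.

Let max0_eq0 (x : R) : (Num.max 0 x == 0) = (x <= 0).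
Proof. by rewrite eq_maxl. Qed.

Lemma cell_excess_ge0 v b : 0 <= cell_excess v b.
Proof.
rewrite /cell_excess !addr_ge0// sumr_ge0// => a _.
by rewrite sumr_ge0.
Qed.

Lemma cell_excessE v b : cell_excess v b = 0 <-> cell v b.
Proof.
have S1 : 0 <= \sum_(a in v) Num.max 0 (enorm (b - val a) - r).
  by rewrite sumr_ge0.
have S2 : 0 <= \sum_(a in v) \sum_(a' | a' \notin v)
      Num.max 0 (enorm (b - val a) - enorm (b - val a')).
  by rewrite sumr_ge0// => a _; rewrite sumr_ge0.
split=> [/eqP|[kv [Bv Vv]]].
  rewrite paddr_eq0 ?addr_ge0// paddr_eq0// pnatr_eq0 eqb0 -leqNgt.
  rewrite !psumr_eq0//; last by move=> a _; rewrite sumr_ge0.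
  case/andP=> /andP[kv /allP Bv] /allP Vv; split=> //; split.
    move=> a av; have := Bv a (mem_index_enum a).
    by rewrite av/= max0_eq0 subr_le0.
  move=> a a' av av'; have := Vv a (mem_index_enum a); rewrite av/= psumr_eq0//.
  move=> /allP/(_ a' (mem_index_enum a')).
  by rewrite av'/= max0_eq0 subr_le0.
rewrite /cell_excess ltnNge kv add0r !big1 ?addr0// => a av.
  by rewrite big1// => a' av'; apply/eqP; rewrite max0_eq0 subr_le0; exact: Vv.
by apply/eqP; rewrite max0_eq0 subr_le0; exact: Bv.
Qed.

Lemma cell_excess_continuous v : continuous (cell_excess v).
Proof.
apply: continuous_addv.
  apply: continuous_addv; first exact: cst_continuous.
  apply: continuous_sumv => a _; apply: continuous_maxr; first exact: cst_continuous.
  by apply: continuous_subv; [exact: enorm_continuous|exact: cst_continuous].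
apply: continuous_sumv => a _; apply: continuous_sumv => a' _.
apply: continuous_maxr; first exact: cst_continuous.
by apply: continuous_subv; exact: enorm_continuous.
Qed.

(** * The inverse of the projection to S-Del *)

Definition rescale t : {ptws V -> R} := fun v => #|{: V}|%:R * t v.
Definition SDel_center t : E := nerve_map cell (rescale t).
Definition SDel_core t : {ptws V -> R} := soften predT (rescale t).

Lemma rescale_continuous : continuous rescale.
Proof.
apply: continuous_ptws => v; apply: continuous_mulr; first exact: cst_continuous.
exact: ptws_eval_continuous.
Qed.

Lemma SDel_center_continuous : continuous SDel_center.
Proof.
exact: (continuous_compose rescale_continuous (@nerve_map_continuous _ _ _ _)).
Qed.

Lemma SDel_core_continuous : continuous SDel_core.
Proof.
exact: (continuous_compose rescale_continuous (@soften_continuous _ _ _)).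
Qed.

(** Some weight is at least the average; this fixes the factor in [rescale]. *)
Lemma exists_rescale_ge1 t : (\sum_v t v = 1) -> exists2 v, true & 1 <= rescale t v.
Proof.
move=> t1; apply: contrapT => tn.
suff : \sum_v rescale t v < #|{: V}|%:R.
  by rewrite -mulr_sumr t1 mulr1 ltxx.
rewrite -sumr_const; apply: ltr_sum; last first.
  by move=> v _; rewrite ltNge; apply/negP => tv; apply: tn; exists v.
by apply/hasP; exists finset.set0; rewrite ?mem_index_enum.
Qed.

Lemma in_cell_core i b t : in_cell r i b t -> in_cell r i b (SDel_core t).
Proof.
move=> [t0 t1 tD]; split; first by move=> v; exact: soften_ge0.
  exact/sum_soften/exists_rescale_ge1.
move=> v /soften_neq0[_ tv]; apply: tD; apply: contraTN tv => /eqP tv.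
by rewrite /rescale tv mulr0 -leNgt invr_ge0 ler0n.
Qed.

(** Weights surviving in the core exceed 1/2 after rescaling, so the centre lies in their cells; [b]
    witnesses that the support of [t] is a simplex. *)
Lemma in_cell_center i b t : (k <= i)%N -> in_cell r i b t ->
  in_cell r i (SDel_center t) (SDel_core t).
Proof.
move=> ki tC; have [c0 c1 cD] := in_cell_core tC.
have [t0 t1 tD] := tC; split=> // v cv; split; first by have [] := cD v cv.
have [_ tv] := soften_neq0 cv.
suff [] : cell v (SDel_center t) by [].
apply: nerve_map_in => //.
- exact: cell_convex.
- by move=> u; rewrite mulr_ge0.
- exists b => u; rewrite mulf_eq0 negb_or => /andP[_ /tD[ui uD]].
  by split=> //; case: ui => ->//; exact: leqW.
- exact: ltW.
Qed.

(** * Centres and level paths over the multicover *)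

Definition near_cell b : {ptws V -> R} := near_weight cell cell_excess b.
Definition Cov_center b : E := nerve_map cell (near_cell b).

Lemma near_cell_continuous : continuous near_cell.
Proof.
by apply: near_weight_continuous; [exact: cell_excess_ge0|exact: cell_excessE|
  exact: cell_excess_continuous].
Qed.

Lemma Cov_center_continuous : continuous Cov_center.
Proof.
exact: (continuous_compose near_cell_continuous (@nerve_map_continuous _ _ _ _)).
Qed.

Lemma near_cell1 b v : cell v b -> near_cell b v = 1.
Proof. by apply: near_weight1; exact: cell_excessE. Qed.

Lemma Cov_center_half b v : 2^-1 <= near_cell b v -> cell v (Cov_center b).
Proof.
apply: nerve_map_in.
- exact: cell_convex.
- exact: near_weight_ge0.
- by apply: near_weight_nerve; [exact: cell_excess_ge0|exact: cell_excessE].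
Qed.

Lemma Cov_center_in b v : cell v b -> cell v (Cov_center b).
Proof. by move=> vb; apply: Cov_center_half; rewrite near_cell1//; lra. Qed.

(** Tent function, whose integer translates sum to 1. *)
Definition hat (x : R) : R := Num.max 0 (1 - `|x|).

(* For y = i + x with 0 <= x <= 1, total weight 1 - x on the sets of size i and
   x on those of size i+1. *)
Definition level_path (y : R) b : {ptws V -> R} := fun v =>
  hat (y - #|v|%:R) * soften (fun u : V => #|u| == #|v|) (near_cell b) v.

Lemma hat_neq0 i (y : R) v : i%:R <= y <= i.+1%:R -> hat (y - #|v|%:R) != 0 ->
  #|v| = i \/ #|v| = i.+1.
Proof.
move=> /andP[iy yi]; rewrite /hat max0_eq0 -ltNge subr_gt0 ltr_norml => /andP[h1 h2].
have : (#|v| < i.+2)%N by rewrite -(ltr_nat R) -[i.+2]addn1 natrD; lra.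
have : (i <= #|v|)%N by rewrite -ltnS -(ltr_nat R) -[#|v|.+1]addn1 natrD; lra.
rewrite leq_eqVlt => /orP[/eqP->|iv vi]; first by left.
by right; apply/eqP; rewrite eqn_leq -ltnS vi iv.
Qed.

Lemma level_path_in i (y : R) b (w : V) : (k <= i)%N -> i%:R <= y <= i.+1%:R ->
  (Ball r w `&` Vor w) b -> y <= #|w|%:R ->
  in_cell r i (Cov_center b) (level_path y b).
Proof.
move=> ki iy wb yw; have [iy1 iy2] := andP iy.
(* A point covered |w| times is covered j times, so some set of size j has [b] in its cell and near
   weight 1, as [sum_soften] requires. *)
have soft1 j : (k <= j <= #|w|)%N ->
    \sum_(u : V | #|u| == j) soften (fun u : V => #|u| == j) (near_cell b) u = 1.
  move=> /andP[kj jw].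
  have /CovP[S [Sj SD]] : Cov A r j b.
    apply: (leq_trans jw).
    by have /CovP : exists S : V, #|S| = #|w| /\ (Ball r S `&` Vor S) b by exists w.
  apply: sum_soften; exists S; first by rewrite Sj.
  by rewrite near_cell1//; split=> //; rewrite Sj.
have lvl j : \sum_(v : V | #|v| == j) level_path y b v = hat (y - j%:R) *
    \sum_(u : V | #|u| == j) soften (fun u : V => #|u| == j) (near_cell b) u.
  by rewrite mulr_sumr; apply: eq_bigr => v /eqP vj; rewrite /level_path vj.
split.
- by move=> v; apply: mulr_ge0; [exact: max0_ge0|exact: soften_ge0].
- rewrite (bigID (fun v : V => #|v| == i))/= lvl soft1; last first.
    by rewrite ki -(ler_nat R); exact: le_trans yw.
  rewrite (bigID (fun v : V => #|v| == i.+1))/=.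
  rewrite [X in _ + (_ + X)]big1 => [|v /andP[vi vi1]]; last first.
    apply/eqP; rewrite mulf_eq0; apply/orP; left; apply/negPn/negP.
    by move=> /(hat_neq0 iy)[/eqP|/eqP]; [rewrite (negbTE vi)|rewrite (negbTE vi1)].
  rewrite (eq_bigl (fun v : V => #|v| == i.+1)) => [|v]; last first.
    by case: (#|v| =P i.+1) => [->|]; rewrite ?andbF ?gtn_eqF.
  rewrite lvl addr0 mulr1.
  have iy3 : y <= i%:R + 1 by rewrite natr1.
  have hi : hat (y - i%:R) = 1 - (y - i%:R).
    by rewrite /hat ger0_norm ?subr_ge0// max_r//; lra.
  have hi1 : hat (y - i.+1%:R) = y - i%:R.
    rewrite /hat -[i.+1%:R]natr1 ler0_norm; last lra.
    by rewrite max_r; lra.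
  (* At y = i, [w] may have size i and level i+1 may be empty, but its tent vanishes. If y > i, then
     [w] has size at least i+1. *)
  have [yi|yi] := eqVneq y i%:R.
    by rewrite hi hi1 yi subrr mul0r subr0 addr0.
  rewrite soft1 ?mulr1; last first.
    by rewrite (leqW ki) -(ltr_nat R) (lt_le_trans _ yw)// lt_def yi.
  by rewrite hi hi1 subrK.
- move=> v; rewrite mulf_eq0 negb_or => /andP[/(hat_neq0 iy) vi].
  move=> /soften_neq0[_ /ltW/Cov_center_half[]].
  by [].
Qed.

Lemma level_path_continuous :
  continuous (fun z : R * E => level_path z.1 z.2).
Proof.
have c1 : continuous (fun z : R * E => z.1) by move=> z; exact: cvg_fst.
have c2 : continuous (fun z : R * E => z.2) by move=> z; exact: cvg_snd.
apply: continuous_ptws => v; apply: continuous_mulr.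
  apply: continuous_maxr; first exact: cst_continuous.
  apply: continuous_subv; first exact: cst_continuous.
  apply: (@continuous_compose _ R); last exact: norm_continuous.
  by apply: continuous_subv => //; exact: cst_continuous.
apply: (@continuous_compose _ {ptws V -> R} _
  (fun z : R * E => soften (fun u : V => #|u| == #|v|) (near_cell z.2))
  (fun t => t v)); last exact: ptws_eval_continuous.
apply: (@continuous_compose _ {ptws V -> R} _ (fun z : R * E => near_cell z.2));
  last exact: soften_continuous.
exact: (continuous_compose c2 near_cell_continuous).
Qed.

Definition mean_level t : R := \sum_(v : V) #|v|%:R * t v.

Lemma mean_level_continuous : continuous mean_level.
Proof.
apply: continuous_sumv => v _; apply: continuous_mulr; first exact: cst_continuous.
exact: ptws_eval_continuous.
Qed.

Lemma mean_level_itv i b t : in_cell r i b t -> i%:R <= mean_level t <= i.+1%:R.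
Proof.
move=> [t0 t1 tD]; have tn (n : nat) : n%:R = \sum_v n%:R * t v by rewrite -mulr_sumr t1 mulr1.
rewrite (tn i) (tn i.+1).
apply/andP; split; apply: ler_sum => v _; have [->|tv] := eqVneq (t v) 0;
  rewrite ?mulr0//; apply: ler_wpM2r; rewrite ?t0// ler_nat;
  by have [[->|->] _] := tD v tv.
Qed.

(** If all sizes in the support were below their mean, the weighted deviations would be nonnegative
    with sum 0, forcing t = 0. The set found is the [w] of [level_path_in]. *)
Lemma mean_level_le i b t : in_cell r i b t ->
  exists2 w : V, (Ball r w `&` Vor w) b & mean_level t <= #|w|%:R.
Proof.
move=> [t0 t1 tD]; apply: contrapT => tn.
have lev v : t v != 0 -> #|v|%:R < mean_level t.
  by move=> tv; rewrite ltNge; apply/negP => lv; apply: tn; exists v => //;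
    have [] := tD v tv.
have : \sum_(v : V) (mean_level t - #|v|%:R) * t v = 0.
  under eq_bigr do rewrite mulrBl.
  by rewrite sumrB -mulr_sumr t1 mulr1 subrr.
move/eqP; rewrite psumr_eq0 => [/allP tz|v _]; last first.
  have [->|tv] := eqVneq (t v) 0; first by rewrite mulr0.
  by rewrite mulr_ge0// subr_ge0 ltW// lev.
move: t1; rewrite big1 => [/esym/eqP|v _]; first by rewrite oner_eq0.
have := tz v (mem_index_enum v); rewrite /= mulf_eq0 subr_eq0.
have [->//|tv] := eqVneq (t v) 0.
by rewrite orbF gt_eqF ?lev.
Qed.

End FixedIndex.
End Blowup.

(** * The two projections *)

Section BlowupEquivalences.
Context {R : realType} {d : nat}.
Context (A : {fset 'rV[R]_d}) (r : R) (k : nat).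
Local Notation E := 'rV[R]_d.
Local Notation V := {set A}.
Local Notation Z := (blowup (A := A) r k).

Let fst_cts (T U : topologicalType) : continuous (fun z : T * U => z.1).
Proof. by move=> z; exact: cvg_fst. Qed.

Let snd_cts (T U : topologicalType) : continuous (fun z : T * U => z.2).
Proof. by move=> z; exact: cvg_snd. Qed.

Let time_continuous (T : topologicalType) (a c : R) :
  continuous (fun z : R * T => clamp01 (a * z.1 - c)).
Proof.
apply: continuous_clamp01; apply: continuous_subv; last exact: cst_continuous.
by apply: continuous_mulr; [exact: cst_continuous|exact: fst_cts].
Qed.

Let comb_continuous (T : topologicalType) (s : T -> R) (f g : T -> E) :
  continuous s -> continuous f -> continuous g ->
  continuous (fun x => (1 - s x) *: f x + s x *: g x).
Proof.
move=> cs cf cg; apply: continuous_addv; apply: continuous_scalev => //.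
by apply: continuous_subv => //; exact: cst_continuous.
Qed.

(* Concatenates two homotopies: t moves for s <= 1/2, b for s >= 1/2. *)
Definition to_core (s : R) (z : E * {ptws V -> R}) : E * {ptws V -> R} :=
  ((1 - clamp01 (2 * s - 1)) *: z.1
     + clamp01 (2 * s - 1) *: SDel_center r k z.2,
   mix (clamp01 (2 * s - 0)) z.2 (SDel_core z.2)).

Lemma to_core_continuous :
  continuous (fun z : R * (E * {ptws V -> R}) => to_core z.1 z.2).
Proof.
have c2 := continuous_compose (@snd_cts R (E * {ptws V -> R})%type)
  (@snd_cts E {ptws V -> R}).
apply: continuous_pairv; last first.
  apply: continuous_mix => //; first exact: time_continuous.
  exact: (continuous_compose c2 (@SDel_core_continuous _ _ _)).
apply: comb_continuous; first exact: time_continuous.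
  exact: (continuous_compose (@snd_cts _ _) (@fst_cts _ _)).
exact: (continuous_compose c2 (@SDel_center_continuous _ _ _ _ _)).
Qed.

(** The order matters: the centre is known to lie only in the cells of the core, so [t] is truncated
    before [b] moves. *)
Lemma to_core_blowup s z : 0 <= s <= 1 -> Z z -> Z (to_core s z).
Proof.
move=> s01 [i ki zC]; exists i => //=.
have [s2|s2] := leP (2 * s) 1.
  rewrite (clamp01_le0 (_ : 2 * s - 1 <= 0)) ?subr_le0//.
  rewrite subr0 scale1r scale0r addr0.
  by apply: in_cell_mix; [exact: clamp01_itv|by []|exact: in_cell_core].
rewrite (clamp01_ge1 (_ : 1 <= 2 * s - 0)) ?subr0 ?ltW// mix1.
apply: in_cell_move; [exact: clamp01_itv|exact: in_cell_core|].
exact: in_cell_center zC.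
Qed.

Lemma SDel_homotopy_equivalence :
  homotopy_equivalence R (restr_map (@blowup_SDel _ _ A r k)).
Proof.
apply: (@homotopy_equivalence_restr _ _ _ _ _ _
  (fun t => (SDel_center r k t, SDel_core t)) _ to_core
  (fun s t => mix s t (SDel_core t))).
- exact: snd_cts.
- apply: continuous_pairv; first exact: SDel_center_continuous.
  exact: SDel_core_continuous.
- by move=> t /SDelP[b [i ki bC]]; exists i => //=; exact: in_cell_center bC.
- exact: to_core_continuous.
- exact: to_core_blowup.
- move=> [b t] _; rewrite /to_core !mulr0 subr0 (clamp01_le0 (lexx 0)) mix0.
  by rewrite clamp01_le0 ?sub0r ?lerN10// subr0 scale1r scale0r addr0.
- move=> [b t] _; rewrite /to_core mulr1 subr0 clamp01_ge1; last lra.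
  by rewrite clamp01_ge1 ?mix1 ?subrr ?scale0r ?add0r ?scale1r//; lra.
- apply: continuous_mix; [exact: fst_cts|exact: snd_cts|].
  exact: (continuous_compose (@snd_cts _ _) (@SDel_core_continuous _ _ _)).
- move=> s t s01 /SDelP[b [i ki tC]]; apply/SDelP; exists b; exists i => //=.
  by apply: in_cell_mix => //; exact: in_cell_core.
- by move=> t _; exact: mix0.
- by move=> t _; exact: mix1.
Qed.

(* Concatenates three homotopies: b moves for s <= 1/3, then t moves within the
   fibre over the new b to its level path, which is followed for s >= 2/3. *)
Definition descend (s : R) (z : E * {ptws V -> R}) : E * {ptws V -> R} :=
  ((1 - clamp01 (3 * s - 0)) *: z.1
     + clamp01 (3 * s - 0) *: Cov_center A r k z.1,
   mix (clamp01 (3 * s - 1)) z.2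
     (level_path r k (k%:R + (1 - clamp01 (3 * s - 2)) * (mean_level z.2 - k%:R))
        z.1)).

Lemma descend_continuous :
  continuous (fun z : R * (E * {ptws V -> R}) => descend z.1 z.2).
Proof.
have c1 := continuous_compose (@snd_cts R (E * {ptws V -> R})%type)
  (@fst_cts E {ptws V -> R}).
have c2 := continuous_compose (@snd_cts R (E * {ptws V -> R})%type)
  (@snd_cts E {ptws V -> R}).
apply: continuous_pairv.
  apply: comb_continuous => //; first exact: time_continuous.
  exact: (continuous_compose c1 (@Cov_center_continuous _ _ _ _ _)).
apply: continuous_mix => //; first exact: time_continuous.
apply: (@continuous_compose _ (R * E)%type _ (fun z : R * (E * {ptws V -> R}) =>
  (k%:R + (1 - clamp01 (3 * z.1 - 2)) * (mean_level z.2.2 - k%:R), z.2.1))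
  (fun z => level_path r k z.1 z.2)); last exact: level_path_continuous.
apply: continuous_pairv => //; apply: continuous_addv; first exact: cst_continuous.
apply: continuous_mulr; apply: continuous_subv; try exact: cst_continuous.
  exact: time_continuous.
exact: (continuous_compose c2 (@mean_level_continuous _ _ _)).
Qed.

Lemma in_cell_Cov_center i b (t : {ptws V -> R}) : (k <= i)%N ->
  in_cell r i b t -> in_cell r i (Cov_center A r k b) t.
Proof.
move=> ki [t0 t1 tD]; split=> // v tv; have [vi vb] := tD v tv; split=> //.
suff [] : cell r k v (Cov_center A r k b) by [].
by apply: Cov_center_in; split=> //; case: vi => ->//; exact: leqW.
Qed.

Lemma descend_blowup s z : 0 <= s <= 1 -> Z z -> Z (descend s z).
Proof.
move=> s01 [i ki zC]; have [w wb lw] := mean_level_le zC.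
have /andP[il li] := mean_level_itv zC.
have kl : k%:R <= mean_level z.2 by rewrite (le_trans _ il)// ler_nat.
rewrite /descend.
have [s1|s1] := leP (3 * s) 1.
  rewrite (clamp01_le0 (_ : 3 * s - 1 <= 0)) ?subr_le0// mix0.
  exists i => //=; apply: in_cell_move => //; first exact: clamp01_itv.
  exact: in_cell_Cov_center.
rewrite (clamp01_ge1 (_ : 1 <= 3 * s - 0)) ?subr0 ?ltW// subrr scale0r add0r.
(* Up to time 2/3 the level is the mean of [t], which lies in [i, i+1], so [t] and the level path
   share a simplex over the centre. *)
rewrite scale1r; have [s2|s2] := leP (3 * s) 2.
  rewrite (clamp01_le0 (_ : 3 * s - 2 <= 0)) ?subr_le0// subr0 mul1r [k%:R + _]addrC subrK.
  exists i => //=; apply: in_cell_mix; first exact: clamp01_itv.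
    exact: in_cell_Cov_center.
  by apply: (level_path_in ki _ wb) => //; rewrite il li.
rewrite (clamp01_ge1 (_ : 1 <= 3 * s - 1)); last lra.
rewrite mix1; set y := k%:R + _.
have /andP[c0 c1] := clamp01_itv (3 * s - 2).
have ky : k%:R <= y by rewrite lerDl mulr_ge0// subr_ge0.
have yl : y <= mean_level z.2 by rewrite /y; nra.
have y0 : 0 <= y by exact: le_trans ky.
have yt := truncn_itv y0; have kt : (k <= Num.truncn y)%N by rewrite truncn_ge_nat.
(* As y falls to k it crosses integers; its integer part selects the current simplex of the
   chain. *)
exists (Num.truncn y) => //=; apply: (level_path_in kt _ wb).
  by have /andP[-> /ltW->] := yt.
exact: le_trans lw.
Qed.

Lemma Cov_homotopy_equivalence :
  homotopy_equivalence R (restr_map (@blowup_Cov _ _ A r k)).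
Proof.
apply: (@homotopy_equivalence_restr _ _ _ _ _ _
  (fun b => (Cov_center A r k b, level_path r k k%:R b)) _ descend
  (fun s b => (1 - s) *: b + s *: Cov_center A r k b)).
- exact: fst_cts.
- apply: continuous_pairv; first exact: Cov_center_continuous.
  apply: (@continuous_compose _ (R * E)%type _ (fun b : E => (k%:R, b))
    (fun z => level_path r k z.1 z.2)); last exact: level_path_continuous.
  apply: continuous_pairv; first exact: cst_continuous.
  by move=> b; exact: cvg_id.
- move=> b /CovP[S [Sk Sb]]; exists k => //=.
  by apply: (level_path_in _ _ Sb); rewrite ?Sk// lexx ler_nat leqnSn.
- exact: descend_continuous.
- exact: descend_blowup.
- move=> [b t] _; rewrite /descend !mulr0 subr0 (clamp01_le0 (lexx 0)).
  by rewrite clamp01_le0 ?sub0r ?lerN10// mix0 subr0 scale1r scale0r addr0.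
- move=> [b t] _; rewrite /descend mulr1 subr0 clamp01_ge1; last lra.
  rewrite clamp01_ge1; last lra.
  rewrite clamp01_ge1; last lra.
  by rewrite mix1 subrr mul0r addr0 scale0r add0r scale1r.
- apply: comb_continuous; [exact: fst_cts|exact: snd_cts|].
  exact: (continuous_compose (@snd_cts _ _) (@Cov_center_continuous _ _ _ _ _)).
- move=> s b s01 /CovP[S [Sk Sb]]; apply/CovP; exists S; split=> //.
  (* One [S] serves for the whole segment: its cell is convex and contains the centre. *)
  have Cb : cell r k S b by split=> //; rewrite Sk.
  by have [] := cell_convex s01 Cb (Cov_center_in Cb).
- by move=> b _; rewrite subr0 scale1r scale0r addr0.
- by move=> b _; rewrite subrr scale0r add0r scale1r.
Qed.

End BlowupEquivalences.

(** * Assembly of the zigzag *)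

Definition restr_morphism (R : realType) (T U : topologicalType)
    (X : R -> nat -> set T) (Y : R -> nat -> set U)
    (hX : forall r k r' k', idx_le r k r' k' -> X r k `<=` X r' k')
    (hY : forall r k r' k', idx_le r k r' k' -> Y r k `<=` Y r' k')
    (f : T -> U) (cf : continuous f) (fXY : forall r k x, X r k x -> Y r k (f x)) :
  bf_morphism R (bifiltration_of_sets hX) (bifiltration_of_sets hY).
Proof.
apply: (BfMorphism R (bifiltration_of_sets hX) (bifiltration_of_sets hY)
  (fun r k => restr_map (@fXY r k))) => [r k _|r k r' k' h x].
  exact: restr_map_continuous.
exact: val_inj.
Defined.

Theorem theorem4 (R : realType) (d : nat) (A : {fset 'rV[R]_d}) :
  weakly_equivalent (Cov_bifiltration A) (SDel_bifiltration A).
Proof.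
have fstc : continuous (fun z : 'rV[R]_d * {ptws {set A} -> R} => z.1).
  by move=> z; exact: cvg_fst.
have sndc : continuous (fun z : 'rV[R]_d * {ptws {set A} -> R} => z.2).
  by move=> z; exact: cvg_snd.
(* Only the projections must be natural in the index; their homotopy inverses depend on [r] and [k]
   and are used one index at a time. *)
apply: (@zigzag_bwd _ _ _ _ (restr_morphism (@blowup_mono _ _ A)
  (@Cov_mono R d A) fstc (@blowup_Cov _ _ A))).
  by move=> r k _; exact: Cov_homotopy_equivalence.
apply: (@zigzag_fwd _ _ _ _ (restr_morphism (@blowup_mono _ _ A)
  (@SDel_mono R d A) sndc (@blowup_SDel _ _ A))).
  by move=> r k _; exact: SDel_homotopy_equivalence.
exact: zigzag_refl.
Qed.
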